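(* For every $n$, the bimodal logic $[\mathbf{K}+\square^n\bot,\mathbf{S5}]^{\mathrm{EX}}$ is locally tabular.
   Context: All propositional modal logics are normal. $\mathbf{K}$ is the minimal normal modal logic in the language with $\square$, and $\mathbf{S5}$ is in the language with the modality $\blacksquare$. $L+A$ denotes the smallest normal modal logic containing $L$ and the formula $A$; $\square^n$ is $\square$ iterated $n$ times. For a monomodal logic $\Lambda$ (in $\square$), $[\Lambda,\mathbf{S5}]^{\mathrm{EX}}:=\Lambda*\mathbf{S5}+(\square\blacksquare p\to\blacksquare\square p)$, where $*$ denotes fusion (the smallest normal bimodal logic containing both). A propositional logic $L$ is locally tabular if for every finite $k$ there are only finitely many formulas in $k$ fixed proposition letters up to $L$-equivalence ($A,B$ are $L$-equivalent if $A\leftrightarrow B\in L$). *)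

(* Defs.v *)
(* Propositional modal logics over a set [I] of box modalities, using plain
   inductive types and Stdlib lists. *)
From Stdlib Require Import List.

Set Implicit Arguments.
Unset Strict Implicit.

Inductive form (I : Type) : Type :=
| Var : nat -> form I
| Bot : form I
| Imp : form I -> form I -> form I
| Box : I -> form I -> form I.

Arguments Var {I} _.
Arguments Bot {I}.

Section Formulas.
Context {I : Type}.

Definition Neg (A : form I) : form I := Imp A Bot.
Definition And (A B : form I) : form I := Neg (Imp A (Neg B)).
Definition Iff (A B : form I) : form I := And (Imp A B) (Imp B A).
Definition Dia (i : I) (A : form I) : form I := Neg (Box i (Neg A)).

Fixpoint Boxn (i : I) (n : nat) (A : form I) : form I :=
  match n with
  | 0 => A
  | S m => Box i (Boxn i m A)
  end.

Fixpoint subst (s : nat -> form I) (A : form I) : form I :=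
  match A with
  | Var x => s x
  | Bot => Bot
  | Imp B C => Imp (subst s B) (subst s C)
  | Box i B => Box i (subst s B)
  end.

Fixpoint letters_below (k : nat) (A : form I) : Prop :=
  match A with
  | Var x => x < k
  | Bot => True
  | Imp B C => letters_below k B /\ letters_below k C
  | Box _ B => letters_below k B
  end.

(* Boxed formulas are treated as atoms, so that [tautology] singles out the
   substitution instances of classical propositional tautologies. *)
Fixpoint truth (v : form I -> bool) (A : form I) : bool :=
  match A with
  | Bot => false
  | Imp B C => implb (truth v B) (truth v C)
  | Var _ | Box _ _ => v A
  end.

Definition tautology (A : form I) : Prop :=
  forall v : form I -> bool, truth v A = true.

End Formulas.

Definition logic (I : Type) : Type := form I -> Prop.

Record normal (I : Type) (L : logic I) : Prop := Normal {
  normal_taut : forall A, tautology A -> L A;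
  normal_K : forall i A B,
    L (Imp (Box i (Imp A B)) (Imp (Box i A) (Box i B)));
  normal_mp : forall A B, L (Imp A B) -> L A -> L B;
  normal_nec : forall i A, L A -> L (Box i A);
  normal_subst : forall s A, L A -> L (subst s A)
}.

Definition smallest_normal (I : Type) (G : form I -> Prop) : logic I :=
  fun A => forall L : logic I, normal L -> (forall B, G B -> L B) -> L A.

Lemma smallest_normal_normal (I : Type) (G : form I -> Prop) :
  normal (smallest_normal G).
Proof.
  split.
  - intros A HA L HL _. exact (normal_taut HL HA).
  - intros i A B L HL _. exact (normal_K HL i A B).
  - intros A B HAB HA L HL HG.
    exact (normal_mp HL (HAB L HL HG) (HA L HL HG)).
  - intros i A HA L HL HG. exact (normal_nec HL i (HA L HL HG)).
  - intros s A HA L HL HG. exact (normal_subst HL s (HA L HL HG)).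
Qed.

Lemma smallest_normal_incl (I : Type) (G : form I -> Prop) (A : form I) :
  G A -> smallest_normal G A.
Proof. intros HA L _ HG. exact (HG A HA). Qed.

Definition add (I : Type) (L : logic I) (A : form I) : logic I :=
  smallest_normal (fun B => L B \/ B = A).

(* Every monomodal language is [form unit]; which box it stands for is decided
   when it is embedded into the bimodal language by [fusion]. *)
Inductive modality : Type := White | Black.

Fixpoint embed (m : modality) (A : form unit) : form modality :=
  match A with
  | Var x => Var x
  | Bot => Bot
  | Imp B C => Imp (embed m B) (embed m C)
  | Box _ B => Box m (embed m B)
  end.

Definition fusion (L1 L2 : logic unit) : logic modality :=
  smallest_normal (fun A =>
    (exists B, L1 B /\ A = embed White B) \/
    (exists B, L2 B /\ A = embed Black B)).

Definition logicK : logic unit := smallest_normal (fun _ => False).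

Definition axT : form unit := Imp (Box tt (Var 0)) (Var 0).
Definition ax4 : form unit := Imp (Box tt (Var 0)) (Box tt (Box tt (Var 0))).
Definition axB : form unit := Imp (Var 0) (Box tt (Dia tt (Var 0))).

Definition logicS5 : logic unit := add (add (add logicK axT) ax4) axB.

Definition axEX : form modality :=
  Imp (Box White (Box Black (Var 0))) (Box Black (Box White (Var 0))).

Definition EX (L : logic unit) : logic modality := add (fusion L logicS5) axEX.

Definition equivalent (I : Type) (L : logic I) (A B : form I) : Prop :=
  L (Iff A B).

Definition locally_tabular (I : Type) (L : logic I) : Prop :=
  forall k : nat, exists l : list (form I),
    (forall B, In B l -> letters_below k B) /\
    (forall A, letters_below k A -> exists B, In B l /\ equivalent L A B).

(* Main.v *)
(** Put [D d := Box^d Bot] for the white box ("white depth less than [d]").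
    By EX and induction on [d], [D d] implies [■ (D d)], so equivalence under
    [D d] is a congruence for the black box; and equivalence of [A] and [B]
    under [D d] gives equivalence of their white boxes under [D (S d)].  Hence,
    if finitely many formulas represent all formulas under [D d], then under
    [D (S d)] every formula is an S5-combination of the letters and the white
    boxes of those representatives.  Up to equivalence there are finitely many
    such combinations, because a black-boxed formula can be pulled out of the
    scope of a black box.  At [d = n] the hypothesis [D n] is a theorem. *)
From Stdlib Require Import List.
Require Import Defs.
Import ListNotations.

(** * Equivalence under a hypothesis and finite lists of normal forms *)

Definition Ite {I : Type} (c x y : form I) : form I :=
  And (Imp c x) (Imp (Neg c) y).

Definition equiv_under {I : Type} (L : logic I) (D A B : form I) : Prop :=
  L (Imp D (Iff A B)).

Definition represented {I : Type} (L : logic I) (D : form I)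
    (l : list (form I)) (A : form I) : Prop :=
  exists B, In B l /\ equiv_under L D A B.

(** Decision trees that test the members of [l] in order and end in constants: one tree per Boolean
    function of these atoms. *)
Fixpoint boolean {I : Type} (l : list (form I)) : list (form I) :=
  match l with
  | [] => [Bot; Neg Bot]
  | a :: l' =>
      map (fun xy => Ite a (fst xy) (snd xy))
        (list_prod (boolean l') (boolean l'))
  end.

(** S5 normal forms over [l], without nested boxes [i] beyond those inside [l]. The boxed atoms come
    first, so the trees test them at the top, where they can be peeled off. *)
Definition modal_closure {I : Type} (i : I) (l : list (form I)) :
    list (form I) :=
  boolean (map (Box i) (boolean l) ++ l).

Ltac prove_tautology :=
  let v := fresh "v" in
  intro v; unfold Ite; cbn;
  repeat match goal with
  | |- context [truth v ?A] => destruct (truth v A)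
  | |- context [v ?A] => destruct (v A)
  end; reflexivity.

Tactic Notation "by_taut" constr(HL) :=
  apply (normal_taut HL); prove_tautology.

Tactic Notation "by_taut" constr(HL) "from" constr(H1) :=
  refine (normal_mp HL _ H1); by_taut HL.
Tactic Notation "by_taut" constr(HL) "from" constr(H1) constr(H2) :=
  refine (normal_mp HL (normal_mp HL _ H1) H2); by_taut HL.
Tactic Notation "by_taut" constr(HL) "from" constr(H1) constr(H2) constr(H3) :=
  refine (normal_mp HL (normal_mp HL (normal_mp HL _ H1) H2) H3); by_taut HL.

(** * Congruence properties *)

Lemma box_mono {I : Type} (L : logic I) (HL : normal L) (i : I) (A B : form I) :
  L (Imp A B) -> L (Imp (Box i A) (Box i B)).
Proof.
  intro H. exact (normal_mp HL (normal_K HL i A B) (normal_nec HL i H)).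
Qed.

Lemma box_mono2 {I : Type} (L : logic I) (HL : normal L) (i : I)
    (A B C : form I) :
  L (Imp A (Imp B C)) -> L (Imp (Box i A) (Imp (Box i B) (Box i C))).
Proof.
  intro H. pose proof (box_mono L HL i _ _ H) as H1.
  by_taut HL from H1 (normal_K HL i B C).
Qed.

Lemma equiv_under_trans {I : Type} (L : logic I) (HL : normal L)
    (D A B C : form I) :
  equiv_under L D A B -> equiv_under L D B C -> equiv_under L D A C.
Proof. intros H1 H2. unfold equiv_under in *. by_taut HL from H1 H2. Qed.

Lemma equiv_under_imp {I : Type} (L : logic I) (HL : normal L)
    (D A A' B B' : form I) :
  equiv_under L D A A' -> equiv_under L D B B' ->
  equiv_under L D (Imp A B) (Imp A' B').
Proof. intros H1 H2. unfold equiv_under in *. by_taut HL from H1 H2. Qed.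

(** Boxing an equivalence also boxes its hypothesis [D], and [D'] must supply [Box i D]. Taking [D']
    to be [D] serves the black box; taking it to be [Box i D] serves the white one. *)
Lemma equiv_under_box {I : Type} (L : logic I) (HL : normal L) (i : I)
    (D D' A B : form I) :
  L (Imp D' (Box i D)) -> equiv_under L D A B ->
  equiv_under L D' (Box i A) (Box i B).
Proof.
  intros HD H. unfold equiv_under in *.
  assert (H1 : L (Imp D (Imp A B))) by (by_taut HL from H).
  assert (H2 : L (Imp D (Imp B A))) by (by_taut HL from H).
  pose proof (box_mono2 L HL i _ _ _ H1) as H3.
  pose proof (box_mono2 L HL i _ _ _ H2) as H4.
  by_taut HL from HD H3 H4.
Qed.

Lemma represented_equiv {I : Type} (L : logic I) (HL : normal L)
    (D : form I) (l : list (form I)) (A B : form I) :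
  equiv_under L D A B -> represented L D l B -> represented L D l A.
Proof.
  intros H [C [HC HBC]]. exists C.
  split; [exact HC | exact (equiv_under_trans L HL _ _ _ _ H HBC)].
Qed.

(** * Closure of decision trees under connectives *)

(** Two trees over the same list merge branch by branch, since implication commutes with a common
    case split. *)
Lemma boolean_imp {I : Type} (L : logic I) (HL : normal L) (D : form I)
    (l : list (form I)) : forall x y,
  In x (boolean l) -> In y (boolean l) ->
  represented L D (boolean l) (Imp x y).
Proof.
  induction l as [|a l IH]; cbn [boolean].
  - intros x y [<-|[<-|[]]] [<-|[<-|[]]];
      (* The truth table of implication. *)
      [exists (Neg Bot) | exists (Neg Bot) | exists Bot | exists (Neg Bot)];
      (split; [cbn; tauto | unfold equiv_under; by_taut HL]).
  - intros x y Hx Hy.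
    apply in_map_iff in Hx. destruct Hx as [[x1 x2] [<- Hx]].
    apply in_map_iff in Hy. destruct Hy as [[y1 y2] [<- Hy]].
    apply in_prod_iff in Hx, Hy. destruct Hx as [Hx1 Hx2], Hy as [Hy1 Hy2].
    destruct (IH x1 y1 Hx1 Hy1) as [z1 [Hz1 E1]].
    destruct (IH x2 y2 Hx2 Hy2) as [z2 [Hz2 E2]].
    exists (Ite a z1 z2). split.
    + apply in_map_iff. exists (z1, z2).
      split; [reflexivity | apply in_prod; assumption].
    + unfold equiv_under in *. cbn [fst snd]. by_taut HL from E1 E2.
Qed.

Lemma represented_imp {I : Type} (L : logic I) (HL : normal L) (D : form I)
    (l : list (form I)) (A B : form I) :
  represented L D (boolean l) A -> represented L D (boolean l) B ->
  represented L D (boolean l) (Imp A B).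
Proof.
  intros [x [Hx HA]] [y [Hy HB]].
  apply (represented_equiv L HL _ _ _ (Imp x y)).
  - exact (equiv_under_imp L HL _ _ _ _ _ HA HB).
  - exact (boolean_imp L HL D l x y Hx Hy).
Qed.

Lemma represented_bot {I : Type} (L : logic I) (HL : normal L) (D : form I)
    (l : list (form I)) :
  represented L D (boolean l) Bot.
Proof.
  induction l as [|a l [B [HB E]]].
  - exists Bot. split; [left; reflexivity | unfold equiv_under; by_taut HL].
  - exists (Ite a B B). split.
    + apply in_map_iff. exists (B, B).
      split; [reflexivity | apply in_prod; assumption].
    + unfold equiv_under in *. by_taut HL from E.
Qed.

Lemma represented_ite {I : Type} (L : logic I) (HL : normal L) (D : form I)
    (l : list (form I)) (c A B : form I) :
  represented L D (boolean l) c ->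
  represented L D (boolean l) A -> represented L D (boolean l) B ->
  represented L D (boolean l) (Ite c A B).
Proof.
  intros Hc HA HB. unfold Ite, And, Neg.
  repeat apply (represented_imp L HL);
    first [assumption | apply (represented_bot L HL)].
Qed.

(** At the level of [a] the tree branches to truth and falsity; at earlier atoms both branches are
    the same. *)
Lemma represented_atom {I : Type} (L : logic I) (HL : normal L) (D : form I)
    (l : list (form I)) (a : form I) :
  In a l -> represented L D (boolean l) a.
Proof.
  induction l as [|b l IH]; intros Ha; [destruct Ha|].
  destruct Ha as [<-|Ha].
  - destruct (represented_bot L HL D l) as [B [HB E]].
    (* [T] represents truth, in the form [Imp Bot Bot]. *)
    destruct (represented_imp L HL D l Bot Bot) as [T [HT ET]];
      try apply (represented_bot L HL).
    exists (Ite b T B). split.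
    + apply in_map_iff. exists (T, B).
      split; [reflexivity | apply in_prod; assumption].
    + unfold equiv_under in *. by_taut HL from E ET.
  - destruct (IH Ha) as [B [HB E]]. exists (Ite b B B). split.
    + apply in_map_iff. exists (B, B).
      split; [reflexivity | apply in_prod; assumption].
    + unfold equiv_under in *. by_taut HL from E.
Qed.

(** * Pulling boxed formulas out of a box *)

(** Both [c] and its negation persist to accessible points, so the case split can be made before the
    box. *)
Lemma box_ite {I : Type} (L : logic I) (HL : normal L) (i : I)
    (D c x y : form I) :
  L (Imp c (Box i c)) -> L (Imp (Neg c) (Box i (Neg c))) ->
  equiv_under L D (Box i (Ite c x y)) (Ite c (Box i x) (Box i y)).
Proof.
  intros Hpos Hneg. unfold equiv_under.
  (* Here [c] is the hypothesis both inside and outside the box. *)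
  assert (Hc : L (Imp c (Iff (Box i (Ite c x y)) (Box i x)))).
  { apply (equiv_under_box L HL i c);
      [exact Hpos | unfold equiv_under; by_taut HL]. }
  assert (Hn : L (Imp (Neg c) (Iff (Box i (Ite c x y)) (Box i y)))).
  { apply (equiv_under_box L HL i (Neg c));
      [exact Hneg | unfold equiv_under; by_taut HL]. }
  by_taut HL from Hc Hn.
Qed.

(** The list [G] holds the boxed atoms still tested by the tree. Each root test is pulled out of the
    box, while the target list stays fixed. *)
Lemma represented_box_boolean {I : Type} (L : logic I) (HL : normal L) (i : I)
    (D : form I) (l : list (form I))
    (H4 : forall A, L (Imp (Box i A) (Box i (Box i A))))
    (H5 : forall A, L (Imp (Neg (Box i A)) (Box i (Neg (Box i A))))) :
  forall G : list (form I), incl G (map (Box i) (boolean l)) ->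
  forall x, In x (boolean (G ++ l)) ->
  represented L D (modal_closure i l) (Box i x).
Proof.
  induction G as [|c G IH]; intros HG x Hx.
  (* No boxed tests remain: [x] is in [boolean l], so its box is itself an atom. *)
  - apply (represented_atom L HL). apply in_or_app. left.
    exact (in_map (Box i) _ _ Hx).
  - cbn [app boolean] in Hx. apply in_map_iff in Hx.
    destruct Hx as [[x1 x2] [<- Hx]]. apply in_prod_iff in Hx.
    destruct Hx as [Hx1 Hx2]. cbn [fst snd].
    assert (Hc : In c (map (Box i) (boolean l))) by (apply HG; left; reflexivity).
    assert (HG' : incl G (map (Box i) (boolean l)))
      by (intros b Hb; apply HG; right; exact Hb).
    apply (represented_equiv L HL _ _ _ (Ite c (Box i x1) (Box i x2))).
    + apply in_map_iff in Hc. destruct Hc as [b [<- _]].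
      apply (box_ite L HL); [apply H4 | apply H5].
    + apply (represented_ite L HL).
      * apply (represented_atom L HL). apply in_or_app. left. exact Hc.
      * exact (IH HG' x1 Hx1).
      * exact (IH HG' x2 Hx2).
Qed.

Lemma represented_box {I : Type} (L : logic I) (HL : normal L) (i : I)
    (D : form I) (l : list (form I)) (A : form I)
    (H4 : forall A, L (Imp (Box i A) (Box i (Box i A))))
    (H5 : forall A, L (Imp (Neg (Box i A)) (Box i (Neg (Box i A))))) :
  L (Imp D (Box i D)) ->
  represented L D (modal_closure i l) A ->
  represented L D (modal_closure i l) (Box i A).
Proof.
  intros HD [x [Hx E]].
  apply (represented_equiv L HL _ _ _ (Box i x)).
  - exact (equiv_under_box L HL i _ _ _ _ HD E).
  - exact (represented_box_boolean L HL i D l H4 H5 _ (incl_refl _) x Hx).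
Qed.

(** * Letters of the normal forms *)

Lemma boolean_letters {I : Type} (k : nat) (l : list (form I)) :
  (forall B, In B l -> letters_below k B) ->
  forall B, In B (boolean l) -> letters_below k B.
Proof.
  induction l as [|a l IH]; intros Hl B HB.
  - destruct HB as [<-|[<-|[]]]; cbn; tauto.
  - cbn [boolean] in HB. apply in_map_iff in HB.
    destruct HB as [[x y] [<- HB]]. apply in_prod_iff in HB.
    destruct HB as [Hx Hy].
    assert (Hl' : forall C, In C l -> letters_below k C)
      by (intros C HC; apply Hl; right; exact HC).
    pose proof (IH Hl' x Hx). pose proof (IH Hl' y Hy).
    pose proof (Hl a (or_introl eq_refl)).
    cbn. tauto.
Qed.

Lemma modal_closure_letters {I : Type} (k : nat) (i : I) (l : list (form I)) :
  (forall B, In B l -> letters_below k B) ->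
  forall B, In B (modal_closure i l) -> letters_below k B.
Proof.
  intros Hl. apply boolean_letters. intros B HB.
  apply in_app_or in HB. destruct HB as [HB|HB].
  - apply in_map_iff in HB. destruct HB as [C [<- HC]].
    exact (boolean_letters k l Hl C HC).
  - exact (Hl B HB).
Qed.

(** * Finiteness under bounded white depth *)

(** Contraposed, axiom 4 says that [Dia i (Neg (Box i A))] implies [Neg (Box i A)]. Boxing this and
    composing with axiom B for [Neg (Box i A)] gives axiom 5. *)
Lemma box_five {I : Type} (L : logic I) (HL : normal L) (i : I)
    (H4 : forall A, L (Imp (Box i A) (Box i (Box i A))))
    (HB : forall A, L (Imp A (Box i (Dia i A)))) (A : form I) :
  L (Imp (Neg (Box i A)) (Box i (Neg (Box i A)))).
Proof.
  assert (H1 : L (Imp (Box i A) (Neg (Neg (Box i A))))) by by_taut HL.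
  pose proof (box_mono L HL i _ _ H1) as H2.
  assert (H3 : L (Imp (Dia i (Neg (Box i A))) (Neg (Box i A))))
    by (by_taut HL from H2 (H4 A)).
  pose proof (box_mono L HL i _ _ H3) as H5.
  by_taut HL from H5 (HB (Neg (Box i A))).
Qed.

Lemma depth_black_invariant (L : logic modality) (HL : normal L)
    (HEX : forall A,
      L (Imp (Box White (Box Black A)) (Box Black (Box White A)))) (d : nat) :
  L (Imp (Boxn White d Bot) (Box Black (Boxn White d Bot))).
Proof.
  induction d as [|d IH]; cbn [Boxn].
  - by_taut HL.
  - pose proof (box_mono L HL White _ _ IH) as H.
    by_taut HL from H (HEX (Boxn White d Bot)).
Qed.

Lemma finite_under_depth (L : logic modality) (HL : normal L)
    (H4 : forall A, L (Imp (Box Black A) (Box Black (Box Black A))))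
    (HB : forall A, L (Imp A (Box Black (Dia Black A))))
    (HEX : forall A,
      L (Imp (Box White (Box Black A)) (Box Black (Box White A))))
    (k d : nat) :
  exists l : list (form modality),
    (forall B, In B l -> letters_below k B) /\
    (forall A, letters_below k A -> represented L (Boxn White d Bot) l A).
Proof.
  induction d as [|d [l [Hl Hrep]]].
  - exists [Bot]. split.
    + intros B [<-|[]]. exact I.
    + intros A _. exists Bot.
      (* At depth 0 the hypothesis is [Bot], under which all formulas are equivalent. *)
      split; [left; reflexivity | unfold equiv_under; cbn [Boxn]; by_taut HL].
  - set (atoms := map Var (seq 0 k) ++ map (Box White) l).
    exists (modal_closure Black atoms). split.
    + apply modal_closure_letters. intros B HB'.
      apply in_app_or in HB'. destruct HB' as [HB'|HB'];
        apply in_map_iff in HB'; destruct HB' as [x [<- Hx]].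
      * apply in_seq in Hx. exact (proj2 Hx).
      * exact (Hl x Hx).
    + pose proof (depth_black_invariant L HL HEX (S d)) as Hinv.
      assert (Hatom : forall a, In a atoms ->
        represented L (Boxn White (S d) Bot) (modal_closure Black atoms) a).
      { intros a Ha. apply (represented_atom L HL). apply in_or_app.
        right. exact Ha. }
      induction A as [x| |A IHA B IHB|m A IHA]; intros HA.
      * apply Hatom. apply in_or_app. left. apply in_map. apply in_seq.
        split; [apply le_0_n | exact HA].
      * apply (represented_bot L HL).
      * destruct HA as [HA1 HA2].
        exact (represented_imp L HL _ _ _ _ (IHA HA1) (IHB HA2)).
      * destruct m.
        (* A white box lowers the depth, so the outer hypothesis at [d] applies to [A]; a black box
           keeps the depth [S d] and uses [IHA]. *)
        -- destruct (Hrep A HA) as [B [HBl E]].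
           apply (represented_equiv L HL _ _ _ (Box White B)).
           ++ apply (equiv_under_box L HL White (Boxn White d Bot));
                [by_taut HL | exact E].
           ++ apply Hatom. apply in_or_app. right. apply in_map. exact HBl.
        -- exact (represented_box L HL Black _ _ A H4
             (box_five L HL Black H4 HB) Hinv (IHA HA)).
Qed.

(** * Axioms of the bimodal logic and local tabularity *)

Lemma embed_Boxn (m : modality) (n : nat) (A : form unit) :
  embed m (Boxn tt n A) = Boxn m n (embed m A).
Proof. induction n as [|n IH]; cbn; [reflexivity | now rewrite IH]. Qed.

Lemma EX_white (L : logic unit) (A : form unit) :
  L A -> EX L (embed White A).
Proof.
  intro HA. apply smallest_normal_incl. left.
  apply smallest_normal_incl. left. exists A. split; [exact HA | reflexivity].
Qed.

Lemma EX_black (L : logic unit) (A : form unit) :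
  logicS5 A -> EX L (embed Black A).
Proof.
  intro HA. apply smallest_normal_incl. left.
  apply smallest_normal_incl. right. exists A. split; [exact HA | reflexivity].
Qed.

Theorem theorem4p1 :
  forall n : nat, locally_tabular (EX (add logicK (Boxn tt n Bot))).
Proof.
  intros n k.
  set (L := EX (add logicK (Boxn tt n Bot))).
  assert (HL : normal L) by apply smallest_normal_normal.
  (* Substituting [A] for all letters turns each axiom into its scheme. *)
  assert (H4 : forall A, L (Imp (Box Black A) (Box Black (Box Black A)))).
  { intro A. refine (normal_subst HL (fun _ => A) (A := embed Black ax4) _).
    apply EX_black. apply smallest_normal_incl. left.
    apply smallest_normal_incl. right. reflexivity. }
  assert (HB : forall A, L (Imp A (Box Black (Dia Black A)))).
  { intro A. refine (normal_subst HL (fun _ => A) (A := embed Black axB) _).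
    apply EX_black. apply smallest_normal_incl. right. reflexivity. }
  assert (HEX : forall A,
    L (Imp (Box White (Box Black A)) (Box Black (Box White A)))).
  { intro A. refine (normal_subst HL (fun _ => A) (A := axEX) _).
    apply smallest_normal_incl. right. reflexivity. }
  assert (HD : L (Boxn White n Bot)).
  { change (@Bot modality) with (embed White Bot). rewrite <- embed_Boxn.
    apply EX_white. apply smallest_normal_incl. right. reflexivity. }
  destruct (finite_under_depth L HL H4 HB HEX k n) as [l [Hl Hrep]].
  exists l. split; [exact Hl|].
  intros A HA. destruct (Hrep A HA) as [B [HBl E]].
  exists B. split; [exact HBl | exact (normal_mp HL E HD)].
Qed.
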